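(* Let $F_1=\{f_1,\dots,f_\mu\}$ and $F_2=\{f_{\mu+1},\dots,f_\nu\}$ be two ordered finite sets of mappings $f_k:\mathbb{R}^m\times\mathbb{R}^m\to\mathscr{I}^{p,q}$. Let $b,c\in\mathbb{R}$ and let $A,B,C:\mathbb{R}^m\to C\ell_{p,q}$ be three multivector fields that satisfy $A(x)=bB(x)+cC(x)$ for all $x\in\mathbb{R}^m$. Then for all $u\in\mathbb{R}^m$ $$\mathcal{F}_{F_1,F_2}(A)(u)=b\,\mathcal{F}_{F_1,F_2}(B)(u)+c\,\mathcal{F}_{F_1,F_2}(C)(u).$$
   Context: $C\ell_{p,q}$, $p+q=n\in\mathbb{N}$, is the real associative unital geometric (Clifford) algebra of dimension $2^n$ generated by $e_1,\dots,e_n$ with $e_je_k+e_ke_j=2\epsilon_j\delta_{jk}$, $\epsilon_j=1$ for $j\le p$, $\epsilon_j=-1$ for $j>p$. Its elements are called multivectors; a multivector field is a map $\mathbb{R}^m\to C\ell_{p,q}$. The exponential of a multivector is $e^{A}=\sum_{j\ge0}A^j/j!$. $\mathscr{I}^{p,q}=\{0\}\cup\{i\in C\ell_{p,q}: i^2 \text{ is a negative real number}\}$. For ordered finite sets $F_1=\{f_1,\dots,f_\mu\}$, $F_2=\{f_{\mu+1},\dots,f_\nu\}$ of mappings $f_k:\mathbb{R}^m\times\mathbb{R}^m\to\mathscr{I}^{p,q}$, the geometric Fourier transform (GFT) of $A$ is $$\mathcal{F}_{F_1,F_2}(A)(u)=\int_{\mathbb{R}^m}\prod_{f\in F_1}e^{-f(x,u)}\,A(x)\prod_{f\in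 F_2}e^{-f(x,u)}\,d^mx,\qquad u\in\mathbb{R}^m,$$ where products are taken from left to right in increasing order of the index and an empty product is $1$. All multivector fields are assumed to be such that the integrals defining the transforms in the statement exist. *)

(* Defs.v *)
From HB Require Import structures.
From mathcomp Require Import all_boot all_order all_algebra.
From mathcomp Require Import all_classical all_reals all_analysis.

Set Implicit Arguments.
Unset Strict Implicit.
Unset Printing Implicit Defensive.

Import Order.TTheory GRing.Theory Num.Theory.
Import numFieldNormedType.Exports.

Local Open Scope classical_set_scope.
Local Open Scope ring_scope.

(* The algebra $C\ell_{p,q}$ is realised on the 2^(p+q)-dimensional space with
   basis the blades e_S = e_{s_1} ... e_{s_k}, where S = {s_1 < ... < s_k}
   ranges over the subsets of 'I_(p + q); the coordinate at e_S is stored at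
   index enum_rank S, so that the norm and the topology are those of the row
   vectors. *)
Definition clifford (R : realType) (p q : nat) : Type :=
  'rV[R]_#|{set 'I_(p + q)}|.

HB.instance Definition _ (R : realType) p q :=
  NormedModule.copy (clifford R p q) 'rV[R]_#|{set 'I_(p + q)}|.
HB.instance Definition _ (R : realType) p q :=
  Complete.copy (clifford R p q) 'rV[R]_#|{set 'I_(p + q)}|.
HB.instance Definition _ (R : realType) p q :=
  Vector.copy (clifford R p q) 'rV[R]_#|{set 'I_(p + q)}|.

Section Clifford.
Context {R : realType} {p q : nat}.
Local Notation n := (p + q)%N.
Local Notation Cl := (clifford R p q).

Definition signature (i : 'I_n) : R := if (i < p)%N then 1 else -1.

Definition cl_coef (S : {set 'I_n}) (a : Cl) : R :=
  (a : 'rV[R]_#|{set 'I_n}|) ord0 (enum_rank S).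

Definition cl_blade (S : {set 'I_n}) : Cl :=
  (delta_mx ord0 (enum_rank S) : 'rV[R]_#|{set 'I_n}|).

(* e_S e_T = blade_sign S T *: e_(S symdiff T): sorting the concatenated word
   transposes every pair (s, t) with t < s, and every common index i
   contributes e_i ^ 2 = signature i. *)
Definition blade_sign (S T : {set 'I_n}) : R :=
  \prod_(s in S) \prod_(t in T)
    (if s == t then signature s else if (t < s)%N then -1 else 1).

Definition symdiff (S T : {set 'I_n}) : {set 'I_n} := (S :\: T) :|: (T :\: S).

Definition cl_one : Cl := cl_blade finset.set0.

Definition cl_mul (a b : Cl) : Cl :=
  \sum_S \sum_T (cl_coef S a * cl_coef T b * blade_sign S T)
    *: cl_blade (symdiff S T).

Lemma cl_coefD S : {morph cl_coef S : a b / a + b}.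
Proof. by move=> a b; rewrite /cl_coef mxE. Qed.

Lemma cl_coefZ S k (a : Cl) : cl_coef S (k *: a) = k * cl_coef S a.
Proof. by rewrite /cl_coef mxE. Qed.

Lemma cl_coef_blade S T : cl_coef S (cl_blade T) = (S == T)%:R.
Proof. by rewrite /cl_coef /cl_blade mxE eqxx (inj_eq enum_rank_inj). Qed.

Lemma cl_coef0 S : cl_coef S 0 = 0.
Proof. by rewrite /cl_coef mxE. Qed.

Lemma cl_coef_sum S I (r : seq I) (P : pred I) (F : I -> Cl) :
  cl_coef S (\sum_(i <- r | P i) F i) = \sum_(i <- r | P i) cl_coef S (F i).
Proof. exact: (big_morph _ (cl_coefD S) (cl_coef0 S)). Qed.

Lemma cl_ext (a b : Cl) : (forall S, cl_coef S a = cl_coef S b) -> a = b.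
Proof.
move=> ab; apply/rowP => i; have := ab (enum_val i).
by rewrite /cl_coef enum_valK.
Qed.

Lemma cl_expand (a : Cl) : a = \sum_S cl_coef S a *: cl_blade S.
Proof.
apply: cl_ext => S; rewrite cl_coef_sum (bigD1 S) //= big1 ?addr0.
  by rewrite cl_coefZ cl_coef_blade eqxx mulr1.
by move=> T /negPf TS; rewrite cl_coefZ cl_coef_blade eq_sym TS mulr0.
Qed.

Lemma cl_mulDl : left_distributive cl_mul +%R.
Proof.
move=> a b c; rewrite /cl_mul -big_split; apply: eq_bigr => S _ /=.
rewrite -big_split; apply: eq_bigr => T _ /=.
by rewrite cl_coefD !mulrDl scalerDl.
Qed.

Lemma cl_mulDr : right_distributive cl_mul +%R.
Proof.
move=> a b c; rewrite /cl_mul -big_split; apply: eq_bigr => S _ /=.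
rewrite -big_split; apply: eq_bigr => T _ /=.
by rewrite cl_coefD mulrDr mulrDl scalerDl.
Qed.

Lemma cl_scaleAl k (a b : Cl) : k *: cl_mul a b = cl_mul (k *: a) b.
Proof.
rewrite /cl_mul scaler_sumr; apply: eq_bigr => S _ /=.
rewrite scaler_sumr; apply: eq_bigr => T _ /=.
by rewrite cl_coefZ scalerA !mulrA.
Qed.

Lemma cl_scaleAr k (a b : Cl) : k *: cl_mul a b = cl_mul a (k *: b).
Proof.
rewrite /cl_mul scaler_sumr; apply: eq_bigr => S _ /=.
rewrite scaler_sumr; apply: eq_bigr => T _ /=.
by rewrite cl_coefZ scalerA !mulrA (mulrC k).
Qed.

Lemma cl_mul0l (a : Cl) : cl_mul 0 a = 0.
Proof. by have := cl_scaleAl 0 0 a; rewrite !scale0r. Qed.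

Lemma cl_mul0r (a : Cl) : cl_mul a 0 = 0.
Proof. by have := cl_scaleAr 0 a 0; rewrite !scale0r. Qed.

Lemma cl_mul_suml I (r : seq I) (P : pred I) (F : I -> Cl) b :
  cl_mul (\sum_(i <- r | P i) F i) b = \sum_(i <- r | P i) cl_mul (F i) b.
Proof.
exact: (big_morph (cl_mul^~ b) (fun x y => cl_mulDl x y b) (cl_mul0l b)).
Qed.

Lemma cl_mul_sumr I (r : seq I) (P : pred I) (F : I -> Cl) a :
  cl_mul a (\sum_(i <- r | P i) F i) = \sum_(i <- r | P i) cl_mul a (F i).
Proof.
exact: (big_morph (cl_mul a) (fun x y => cl_mulDr a x y) (cl_mul0r a)).
Qed.

Lemma cl_mul_blade S T :
  cl_mul (cl_blade S) (cl_blade T) =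
  blade_sign S T *: cl_blade (symdiff S T).
Proof.
rewrite /cl_mul (bigD1 S) //= [X in _ + X]big1 ?addr0; last first.
  move=> U /negPf US; rewrite big1 // => V _.
  by rewrite cl_coef_blade US !mul0r scale0r.
rewrite (bigD1 T) //= big1 ?addr0; last first.
  by move=> V /negPf VT; rewrite !cl_coef_blade VT mulr0 mul0r scale0r.
by rewrite !cl_coef_blade !eqxx !mul1r.
Qed.

Lemma prod_symdiff (F : 'I_n -> R) S T : (forall i, F i * F i = 1) ->
  \prod_(i in symdiff S T) F i = (\prod_(i in S) F i) * \prod_(i in T) F i.
Proof.
move=> FF; rewrite [X in _ = X * _](big_setID T) [X in _ = _ * X](big_setID S).
rewrite mulrACA /=.
rewrite [T :&: S]finset.setIC -[X in _ = X * _]big_split /=.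
rewrite [X in _ = X * _]big1 ?mul1r; last by move=> i _; exact: FF.
rewrite -bigU //=; first by apply: eq_bigl => i; rewrite !inE.
rewrite -setI_eq0; apply/eqP/setP => i; rewrite !inE.
by case: (i \in S); case: (i \in T).
Qed.

Lemma signatureK i : signature i * signature i = 1.
Proof. by rewrite /signature; case: ifP; rewrite ?mulr1 ?mulrNN ?mulr1. Qed.

Let sgn (s t : 'I_n) : R :=
  if s == t then signature s else if (t < s)%N then -1 else 1.

Let sgnK s t : sgn s t * sgn s t = 1.
Proof.
rewrite /sgn; case: eqP => _; first exact: signatureK.
by case: ifP; rewrite ?mulrNN ?mulr1.
Qed.

Lemma blade_sign_symdiffl S T U :
  blade_sign (symdiff S T) U = blade_sign S U * blade_sign T U.
Proof.
by apply: prod_symdiff => s; rewrite -big_split big1 // => t _; exact: sgnK.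
Qed.

Lemma blade_sign_symdiffr S T U :
  blade_sign S (symdiff T U) = blade_sign S T * blade_sign S U.
Proof.
rewrite /blade_sign -big_split; apply: eq_bigr => s _ /=.
by apply: prod_symdiff => t; exact: sgnK.
Qed.

Lemma symdiffA : associative symdiff.
Proof.
move=> S T U; apply/setP => i; rewrite !inE.
by case: (i \in S); case: (i \in T); case: (i \in U).
Qed.

Lemma cl_mul_expandl a b :
  cl_mul a b = \sum_S cl_coef S a *: cl_mul (cl_blade S) b.
Proof.
rewrite [in LHS](cl_expand a) cl_mul_suml.
by apply: eq_bigr => S _; rewrite cl_scaleAl.
Qed.

Lemma cl_mul_expandr a b :
  cl_mul a b = \sum_S cl_coef S b *: cl_mul a (cl_blade S).
Proof.
rewrite [in LHS](cl_expand b) cl_mul_sumr.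
by apply: eq_bigr => S _; rewrite cl_scaleAr.
Qed.

Lemma cl_mulA : associative cl_mul.
Proof.
move=> a b c; rewrite (cl_mul_expandl a (cl_mul b c)) (cl_mul_expandl a b).
rewrite cl_mul_suml; apply: eq_bigr => S _; rewrite -cl_scaleAl.
congr (_ *: _).
rewrite (cl_mul_expandl b c) (cl_mul_expandr (cl_blade S) b).
rewrite cl_mul_suml cl_mul_sumr; apply: eq_bigr => T _.
rewrite -cl_scaleAr -cl_scaleAl; congr (_ *: _).
rewrite (cl_mul_expandr (cl_blade T) c).
rewrite (cl_mul_expandr (cl_mul (cl_blade S) (cl_blade T)) c).
rewrite cl_mul_sumr; apply: eq_bigr => U _.
rewrite -cl_scaleAr; congr (_ *: _).
rewrite !cl_mul_blade -cl_scaleAl -cl_scaleAr !cl_mul_blade !scalerA.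
rewrite blade_sign_symdiffl blade_sign_symdiffr symdiffA.
by congr (_ *: _); rewrite mulrC -mulrA.
Qed.

Lemma blade_sign0l S : blade_sign finset.set0 S = 1.
Proof. by rewrite /blade_sign big_set0. Qed.

Lemma blade_sign0r S : blade_sign S finset.set0 = 1.
Proof. by rewrite /blade_sign big1 // => s _; rewrite big_set0. Qed.

Lemma cl_mul1 : left_id cl_one cl_mul.
Proof.
move=> a; rewrite cl_mul_expandr [in RHS](cl_expand a).
apply: eq_bigr => S _; rewrite cl_mul_blade blade_sign0l scale1r.
by rewrite /symdiff finset.set0D finset.setD0 finset.set0U.
Qed.

Lemma cl_mulr1 : right_id cl_one cl_mul.
Proof.
move=> a; rewrite cl_mul_expandl [in RHS](cl_expand a).
apply: eq_bigr => S _; rewrite cl_mul_blade blade_sign0r scale1r.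
by rewrite /symdiff finset.set0D finset.setD0 finset.setU0.
Qed.

Lemma cl_one_neq0 : cl_one != 0.
Proof.
apply/eqP => /(congr1 (cl_coef finset.set0)).
rewrite cl_coef_blade eqxx cl_coef0.
by move/eqP; rewrite oner_eq0.
Qed.

HB.instance Definition _ := GRing.Zmodule_isNzRing.Build Cl
  cl_mulA cl_mul1 cl_mulr1 cl_mulDl cl_mulDr cl_one_neq0.
HB.instance Definition _ := GRing.Lmodule_isLalgebra.Build R Cl cl_scaleAl.
HB.instance Definition _ := GRing.Lalgebra_isAlgebra.Build R Cl cl_scaleAr.

Lemma cl_mulE (a b : Cl) : a * b = cl_mul a b. Proof. by []. Qed.

Definition cl_gen (i : 'I_n) : Cl := cl_blade [set i]%SET.

Lemma cl_gen_rel (j k : 'I_n) :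
  cl_gen j * cl_gen k + cl_gen k * cl_gen j =
  (2 * signature j * (j == k)%:R)%:A.
Proof.
rewrite !cl_mulE /cl_gen !cl_mul_blade.
have bs (s t : 'I_n) : blade_sign [set s]%SET [set t]%SET = sgn s t.
  by rewrite /blade_sign !big_set1.
have -> : symdiff [set k]%SET [set j]%SET = symdiff [set j]%SET [set k]%SET.
  by rewrite /symdiff finset.setUC.
rewrite !bs -scalerDl /sgn (eq_sym k j); case: (eqVneq j k) => [->|jk].
  rewrite mulr1 /symdiff finset.setDv finset.setU0; congr (_ *: _).
  by rewrite mulr_natl mulr2n.
rewrite mulr0 scale0r.
case: ltngtP jk => [_ _|_ _|/val_inj ->]; last by rewrite eqxx.
- by rewrite addNr scale0r.
- by rewrite addrN scale0r.
Qed.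

Lemma cl_blade_prod_seq (r : seq 'I_n) :
  sorted (fun i j : 'I_n => i < j)%N r ->
  \prod_(i <- r) cl_gen i = cl_blade [set i in r]%SET.
Proof.
elim: r => [_|i r IHr /= ir].
  by rewrite big_nil -[LHS]/(cl_blade finset.set0); congr (cl_blade _).
rewrite big_cons IHr ?(path_sorted ir) // cl_mulE cl_mul_blade.
have {}ir : all (fun j : 'I_n => i < j)%N r.
  by apply: order_path_min ir => x y z; exact: ltn_trans.
have ltr j : j \in r -> (i < j)%N by move/(allP ir).
rewrite /blade_sign big_set1 big1 ?scale1r => [|j]; last first.
  rewrite inE => /ltr ij; rewrite ltnNge (ltnW ij) /=.
  by case: eqP ij => // ->; rewrite ltnn.
congr (cl_blade _); apply/setP => j; rewrite !inE.
by case: eqP => [->|]; case: (boolP (_ \in r)) => //= /ltr; rewrite ltnn.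
Qed.

Lemma cl_blade_prod (S : {set 'I_n}) :
  cl_blade S = \prod_(i < n | i \in S) cl_gen i.
Proof.
rewrite -big_filter cl_blade_prod_seq.
  congr (cl_blade _); apply/setP => i.
  by rewrite inE mem_filter mem_index_enum andbT.
apply: sorted_filter; first by move=> x y z; exact: ltn_trans.
have := iota_ltn_sorted 0 n.
by rewrite -val_enum_ord sorted_map enumT.
Qed.

Lemma dim_clifford : \dim (fullv : {vspace Cl}) = (2 ^ n)%N.
Proof.
rewrite dimvf /dim /= mul1n -[RHS](card_ord (2 ^ n)%N).
by rewrite -cardsT -powersetT card_powerset cardsT !card_ord.
Qed.

Definition cl_exp (a : Cl) : Cl :=
  limn (series (fun j : nat => j`!%:R^-1 *: a ^+ j)).

Lemma cl_coef_le_norm S (a : Cl) : `|cl_coef S a| <= `|a|.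
Proof.
rewrite -[leRHS]/(mx_norm (a : 'rV[R]_#|{set 'I_n}|)) mx_normrE.
by apply/bigmax_geP; right; exists (ord0, enum_rank S).
Qed.

Let K : R := \sum_S \sum_T `|blade_sign S T *: cl_blade (symdiff S T)|.

Let K_ge0 : 0 <= K.
Proof. by apply: sumr_ge0 => S _; exact: sumr_ge0. Qed.

Let cl_norm_mul (a b : Cl) : `|a * b| <= K * `|a| * `|b|.
Proof.
rewrite -mulrA /K big_distrl; apply: le_trans (ler_norm_sum _ _ _) _.
apply: ler_sum => S _; rewrite big_distrl /=.
apply: le_trans (ler_norm_sum _ _ _) _; apply: ler_sum => T _.
rewrite -scalerA normrZ mulrC ler_wpM2l // normrM.
by rewrite ler_pM // cl_coef_le_norm.
Qed.

Let cl_norm_exp (a : Cl) j : `|a ^+ j| <= `|1 : Cl| * (K * `|a|) ^+ j.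
Proof.
elim: j => [|j IHj]; first by rewrite !expr0 mulr1.
rewrite [in leLHS]exprS; apply: le_trans (cl_norm_mul _ _) _.
by rewrite exprS mulrCA ler_wpM2l // mulr_ge0.
Qed.

Lemma is_cvg_cl_exp (a : Cl) :
  cvgn (series (fun j : nat => j`!%:R^-1 *: a ^+ j)).
Proof.
apply: normed_cvg.
apply: (@series_le_cvg _ _ (fun j => `|1 : Cl| * exp_coeff (K * `|a|) j)) => //.
- by move=> j /=.
- by move=> j; rewrite mulr_ge0 // exp_coeff_ge0 // ?mulr_ge0.
- move=> j; rewrite /= normrZ ger0_norm ?invr_ge0 // mulrC /exp_coeff /= mulrA.
  by rewrite ler_wpM2r ?invr_ge0.
- exact/is_cvg_seriesZ/is_cvg_series_exp_coeff.
Qed.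

Definition cl_imag : set Cl :=
  [set i | i = 0 \/ exists2 r : R, r < 0 & i * i = r%:A].

End Clifford.

Arguments cl_imag : clear implicits.

Section LebesgueMeasure.
Context {R : realType}.
Local Notation Rm m := (m.-tuple (measurableTypeR R)).

Section cons.
Variable m : nat.

Definition tuple_cons (z : measurableTypeR R * Rm m) : Rm m.+1 :=
  [tuple of z.1 :: z.2].

Lemma measurable_tuple_cons : measurable_fun setT tuple_cons.
Proof. exact: measurable_cons. Qed.

Definition tuple_uncons (x : Rm m.+1) : measurableTypeR R * Rm m :=
  (thead x, [tuple of behead x]).

Lemma measurable_tuple_uncons : measurable_fun setT tuple_uncons.
Proof.
apply/measurable_fun_pairP; split; last exact: measurable_behead.
exact: measurable_tnth.
Qed.

Lemma tuple_consK : cancel tuple_cons tuple_uncons.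
Proof.
by move=> [x t]; congr pair; rewrite ?theadE //; exact: val_inj.
Qed.

Lemma tuple_unconsK : cancel tuple_uncons tuple_cons.
Proof. by move=> x; rewrite /tuple_cons /= -tuple_eta. Qed.

Variable mu : {sigma_finite_measure set (Rm m) -> \bar R}.

Definition lebesgue_measure_cons : set (Rm m.+1) -> \bar R :=
  pushforward (lebesgue_measure \x mu)%E tuple_cons.

Let mu_cons : {measure set (Rm m.+1) -> \bar R} :=
  measure_function_pushforward__canonical__measure_function_Measure
    (lebesgue_measure \x mu)%E measurable_tuple_cons.

HB.instance Definition _ := isMeasure.Build _ _ _ lebesgue_measure_cons
  (measure0 mu_cons) (measure_ge0 mu_cons)
  (@measure_semi_sigma_additive _ _ _ mu_cons).

Let lebesgue_measure_cons_sigma_finite :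
  sigma_finite setT lebesgue_measure_cons.
Proof.
have /sigma_finiteP[F [TF ndF Foo]] := sigma_finiteT (@lebesgue_measure R).
have /sigma_finiteP[G [TG ndG Goo]] := sigma_finiteT mu.
exists (fun k => tuple_uncons @^-1` (F k `*` G k)) => [|k].
  rewrite -preimage_bigcup (_ : \bigcup_k _ = setT) ?preimage_setT //.
  apply/seteqP; split => // -[x t] _.
  have [i _ Fx] : (\bigcup_k F k) x by rewrite -TF.
  have [j _ Gt] : (\bigcup_k G k) t by rewrite -TG.
  exists (maxn i j) => //; split => /=.
    by move: Fx; apply/subsetPset/ndF; exact: leq_maxl.
  by move: Gt; apply/subsetPset/ndG; exact: leq_maxr.
have [mF Fk] := Foo k; have [mG Gk] := Goo k; split.
  rewrite -[X in measurable X]setTI.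
  by apply: measurable_tuple_uncons => //; exact: measurableX.
rewrite /lebesgue_measure_cons /pushforward -comp_preimage.
rewrite (_ : _ \o _ = id); last by apply/funext => z; exact: tuple_consK.
by rewrite preimage_id product_measure1E// lte_mul_pinfty// ge0_fin_numE.
Qed.

HB.instance Definition _ := @Measure_isSigmaFinite.Build _ _ _
  lebesgue_measure_cons lebesgue_measure_cons_sigma_finite.

End cons.

(* Lebesgue measure on the Borel sets of R^m, as an iterated product *)
Fixpoint borel_lebesgue_measure (m : nat) :
    {sigma_finite_measure set (Rm m) -> \bar R} :=
  match m with
  | 0%N => \d_([tuple] : Rm 0)
  | k.+1 => lebesgue_measure_cons (borel_lebesgue_measure k)
  end.

Lemma measurable_tuple_box m (A : 'I_m -> set (measurableTypeR R)) :
  (forall i, measurable (A i)) ->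
  measurable [set x : Rm m | forall i, A i (tnth x i)].
Proof.
move=> mA; rewrite (_ : [set _ | _] =
    \big[setI/setT]_(i < m) ((fun x : Rm m => tnth x i) @^-1` A i)).
  apply: bigsetI_measurable => i _; rewrite -[X in measurable X]setTI.
  exact: measurable_tnth.
rewrite -bigcap_seq; apply/seteqP; split => x /= xA i; first by move=> _.
by apply: xA => /=; rewrite mem_index_enum.
Qed.

Lemma borel_lebesgue_measure_prod m (A : 'I_m -> set (measurableTypeR R)) :
  (forall i, measurable (A i)) ->
  borel_lebesgue_measure m [set x | forall i, A i (tnth x i)] =
  (\prod_(i < m) lebesgue_measure (A i))%E.
Proof.
elim: m A => [|m IHm] A mA.
  rewrite big_ord0 /= diracE mem_set //.
  by case.
rewrite big_ord_recl /= -IHm; last by move=> i; exact: mA.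
rewrite /lebesgue_measure_cons /pushforward.
rewrite (_ : _ @^-1` _ =
    A ord0 `*` [set x : Rm m | forall i, A (lift ord0 i) (tnth x i)]).
  rewrite product_measure1E //.
  exact: (measurable_tuple_box (fun i => mA (lift ord0 i))).
apply/seteqP; split => -[x t] /=.
  move=> At; split => [|i]; first exact: (At ord0).
  by have := At (lift ord0 i); rewrite tnthS.
move=> [Ax At] i; case: (unliftP ord0 i) => [j|] ->; rewrite ?tnthS //.
Qed.

End LebesgueMeasure.

(* Lebesgue measure on the Lebesgue measurable subsets of R^m *)
Definition lebesgue_measure_tuple (R : realType) (m : nat) :=
  @completed_measure_extension _ _ _ (@borel_lebesgue_measure R m).

HB.instance Definition _ (R : realType) m :=
  Measure.on (@lebesgue_measure_tuple R m).

Lemma lebesgue_measure_tuple_box (R : realType) m (a b : 'I_m -> R) :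
  (forall i, a i <= b i) ->
  @lebesgue_measure_tuple R m [set x | forall i, tnth x i \in `[a i, b i]] =
  (\prod_(i < m) (b i - a i))%:E.
Proof.
move=> ab; rewrite /lebesgue_measure_tuple /completed_measure_extension.
pose A i : set (measurableTypeR R) := `[a i, b i]%classic.
have mA i : measurable (A i) by exact: measurable_itv.
rewrite -[X in (_^*)%mu X]/[set x | forall i, A i (tnth x i)].
rewrite measurable_mu_extE; last by move: (measurable_tuple_box mA).
rewrite [LHS](borel_lebesgue_measure_prod mA).
rewrite (big_morph EFin (@EFinM R) erefl); apply: eq_bigr => i _.
rewrite lebesgue_measure_itv /= lte_fin.
have := ab i; rewrite le_eqVlt => /orP[/eqP ->|->]; last by rewrite EFinB.
by rewrite ltxx subrr.
Qed.

Section GeometricFourierTransform.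
Context {R : realType} {m p q : nat}.
Local Notation Rm := (m.-tuple R).
Local Notation Cl := (clifford R p q).
Local Notation leb := (@lebesgue_measure_tuple R m).

Definition cl_integrable (f : Rm -> Cl) : Prop :=
  forall S : {set 'I_(p + q)},
    leb.-integrable setT (fun x => (cl_coef S (f x))%:E).

Definition cl_integral (f : Rm -> Cl) : Cl :=
  \sum_(S : {set 'I_(p + q)}) (\int[leb]_x cl_coef S (f x)) *: cl_blade S.

Definition gft_kernel := Rm -> Rm -> set_type (cl_imag R p q).

Definition gft_integrand (F1 F2 : seq gft_kernel) (A : Rm -> Cl)
    (u x : Rm) : Cl :=
  (\prod_(f <- F1) cl_exp (- \val (f x u))) * A x *
  (\prod_(f <- F2) cl_exp (- \val (f x u))).

Definition gft_exists F1 F2 A :=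
  forall u, cl_integrable (gft_integrand F1 F2 A u).

Definition gft F1 F2 A (u : Rm) : Cl := cl_integral (gft_integrand F1 F2 A u).

End GeometricFourierTransform.

(* Main.v *)
Require Import Defs.
From mathcomp Require Import all_boot all_order all_algebra.
From mathcomp Require Import all_classical all_reals all_analysis.

Import GRing.Theory Num.Theory.
Local Open Scope ring_scope.

(** The transform is the composite of two real-linear operations. At a fixed
    frequency the integrand depends linearly on the field, because
    multiplication in the Clifford algebra is bilinear over the reals: real
    scalars are central, so they pass through the left product of exponentials
    even though multivectors need not commute with it ([gft_integrand_linear]).
    The Clifford-valued integral is linear on integrable fields, since each
    coordinate is a real Lebesgue integral ([cl_integral_linear]). *)

Lemma gft_integrand_linear (R : realType) (p q m : nat)
    (F1 F2 : seq (@gft_kernel R m p q)) (b c : R)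
    (B C : m.-tuple R -> clifford R p q) (u x : m.-tuple R) :
  gft_integrand F1 F2 (fun y => b *: B y + c *: C y) u x =
  b *: gft_integrand F1 F2 B u x + c *: gft_integrand F1 F2 C u x.
Proof. by rewrite /gft_integrand mulrDr mulrDl -!scalerAr -!scalerAl. Qed.

(** Integrability is what allows the coordinate integrals to be split: without
    it, the extended-real integrals could take infinite values, which the
    real-valued integral sends to 0. *)
Lemma cl_integral_linear (R : realType) (p q m : nat) (b c : R)
    (f g : m.-tuple R -> clifford R p q) :
  cl_integrable f -> cl_integrable g ->
  cl_integral (fun x => b *: f x + c *: g x) =
  b *: cl_integral f + c *: cl_integral g.
Proof.
move=> intf intg; rewrite /cl_integral !scaler_sumr -big_split /=.
apply: eq_bigr => S _; rewrite !scalerA -scalerDl; congr (_ *: _).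
under eq_Rintegral => x _ do rewrite cl_coefD !cl_coefZ.
have scaled_integrable k h : cl_integrable h ->
    (@lebesgue_measure_tuple R m).-integrable setT (fun x => (k * cl_coef S (h x))%:E).
  move=> inth; under eq_fun do rewrite EFinM.
  exact: integrableZl (inth S).
rewrite RintegralD //; try exact: scaled_integrable.
rewrite RintegralZl //; last exact: intf.
rewrite RintegralZl //; exact: intg.
Qed.

Theorem theorem3p2 (R : realType) (p q m : nat)
    (F1 F2 : seq (@gft_kernel R m p q))
    (b c : R) (A B C : m.-tuple R -> clifford R p q)
    (existsA : gft_exists F1 F2 A)
    (existsB : gft_exists F1 F2 B)
    (existsC : gft_exists F1 F2 C)
    (eqA : forall x : m.-tuple R, A x = b *: B x + c *: C x) :
  forall u : m.-tuple R,
    gft F1 F2 A u = b *: gft F1 F2 B u + c *: gft F1 F2 C u.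
Proof.
move=> u; rewrite /gft -cl_integral_linear; [|exact: existsB|exact: existsC].
congr cl_integral; apply/funext => x.
by rewrite -gft_integrand_linear /gft_integrand eqA.
Qed.
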